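(* Let $G$ be a countable amenable group. For any real numbers $\alpha<\beta$ and any $S>0$, there exist $\lambda>0$ and $0<c_0<1$ such that for every $(1+\lambda)$-bi-tempered Følner sequence $(F_n)_{n\ge 1}$ in $G$ there is a constant $c_1>0$ (depending only on the sequence $(F_n)$, and neither on the measure preserving system nor on the function $f$ below) such that for every measure preserving system $(X,\mathscr{B},\mu,(T_g)_{g\in G})$ and every $f\in L^\infty_\mu(X)$ with $\|f\|_\infty\le S$, one has $$\mu(D_N)\le c_1c_0^N\qquad\text{for all } N\in\mathbb{N},$$ where $D_N=D_{(F_n),f,\alpha,\beta,N}$ is the set of $x\in X$ for which the sequence of ergodic averages $(\mathsf{A}_nf(x))_{n\ge1}$ along $(F_n)$ fluctuates across $(\alpha,\beta)$ at least $N$ times.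
   Context: A measure preserving system (m.p.s.) $(X,\mathscr{B},\mu,(T_g)_{g\in G})$ is a measure preserving action of $G$ on a probability space, with $T_gT_h=T_{gh}$. A (left) Følner sequence in $G$ is a sequence $(F_n)$ of finite nonempty subsets of $G$ with $|gF_n\triangle F_n|/|F_n|\to0$ for every $g\in G$; ''Følner sequence'' without further qualification means left Følner sequence. The ergodic averages of a function $f$ on $X$ along $(F_n)$ are $\mathsf{A}_nf=\frac{1}{|F_n|}\sum_{g\in F_n}f\circ T_g$. A real sequence $(a_n)$ fluctuates $N$ times across a gap $(\alpha,\beta)$ if there are integers $n_1<n_2<\dots<n_{2N}$ such that $a_{n_i}\le\alpha$ for odd $i$ and $a_{n_i}\ge\beta$ for even $i$. A sequence $(F_n)$ of finite subsets of $G$ is left $c$-tempered if $\left|\bigcup_{i<n}F_i^{-1}F_n\right|\le c|F_n|$ for all $n$; right $c$-tempered if $\left|\bigcup_{i<n}F_nF_i^{-1}\right|\le c|F_n|$ for all $n$; and $c$-bi-tempered if it is both left and right $c$-tempered. *)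

(* Defs.v *)
From HB Require Import structures.
From mathcomp Require Import all_boot all_order all_algebra finmap.
From mathcomp Require Import all_classical all_reals all_analysis.

Set Implicit Arguments.
Unset Strict Implicit.
Unset Printing Implicit Defensive.

Import Order.TTheory GRing.Theory Num.Theory.
Import numFieldNormedType.Exports.

Local Open Scope classical_set_scope.
Local Open Scope fset_scope.
Local Open Scope ring_scope.

(* Sequences (F_n)_{n >= 1} are represented by functions on nat, the value at
   [n] standing for F_(n+1). *)

Section FiniteSubsets.
Variable G : groupType.
Implicit Types A B : {fset G}.

Definition fset_lmul (g : G) A : {fset G} := [fset (g * x)%g | x in A].
Definition fset_mul A B : {fset G} := [fset (x * y)%g | x in A, y in B].
Definition fset_inv A : {fset G} := [fset (x^-1)%g | x in A].
Definition fset_symdiff A B : {fset G} := (A `\` B) `|` (B `\` A).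

End FiniteSubsets.

Section Folner.
Variables (R : realType) (G : groupType).
Implicit Types F : nat -> {fset G}.

Definition folner F : Prop :=
  (forall n, F n != fset0) /\
  (forall g : G,
     (fun n => #|` fset_symdiff (fset_lmul g (F n)) (F n)|%:R
               / #|` F n|%:R : R) @ \oo --> (0 : R)).

(* Amenability of a countable group: existence of a (left) Folner sequence. *)
Definition amenable : Prop := exists F, folner F.

Definition left_tempered (c : R) F : Prop :=
  forall n,
    #|` \bigcup_(i <- iota 0 n) fset_mul (fset_inv (F i)) (F n)|%:R <= c * #|` F n|%:R.

Definition right_tempered (c : R) F : Prop :=
  forall n,
    #|` \bigcup_(i <- iota 0 n) fset_mul (F n) (fset_inv (F i))|%:R <= c * #|` F n|%:R.

Definition bi_tempered (c : R) F : Prop :=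
  left_tempered c F /\ right_tempered c F.

End Folner.

Record mp_action (R : realType) (G : groupType) (d : measure_display)
    (X : measurableType d) (mu : probability X R) (T : G -> X -> X) : Prop := {
  mp_action1 : forall x, T 1%g x = x;
  mp_actionM : forall g h x, T g (T h x) = T (g * h)%g x;
  mp_action_measurable : forall g, measurable_fun [set: X] (T g);
  mp_action_preserving :
    forall g (A : set X), measurable A -> mu (T g @^-1` A) = mu A }.

Definition ergodic_average (R : realType) (G : groupType) (X : Type)
    (T : G -> X -> X) (F : nat -> {fset G}) (f : X -> R) (n : nat) (x : X) : R :=
  (\sum_(g <- F n) f (T g x)) / #|` F n|%:R.

(* Only the values [t 1], ..., [t (2 N)] of [t] are relevant. *)
Definition fluctuates (R : realType) (alpha beta : R) (N : nat)
    (a : nat -> R) : Prop :=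
  exists t : nat -> nat,
    (forall i j, (1 <= i)%N -> (i < j)%N -> (j <= 2 * N)%N -> (t i < t j)%N) /\
    (forall i, (1 <= i <= 2 * N)%N ->
       if odd i then a (t i) <= alpha else beta <= a (t i)).

Definition fluctuation_set (R : realType) (G : groupType) (X : Type)
    (T : G -> X -> X) (F : nat -> {fset G}) (f : X -> R) (alpha beta : R)
    (N : nat) : set X :=
  [set x | fluctuates alpha beta N (fun n => ergodic_average T F f n x)].

(* Main.v *)
Require Import Defs.
From HB Require Import structures.
From mathcomp Require Import all_boot all_order all_algebra finmap.
From mathcomp Require Import all_classical all_reals all_analysis.
From mathcomp Require Import measurable_realfun ring lra zify.

Set Implicit Arguments.
Unset Strict Implicit.
Unset Printing Implicit Defensive.

Import Order.TTheory GRing.Theory Num.Theory.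
Import numFieldNormedType.Exports.

Local Open Scope classical_set_scope.
Local Open Scope ring_scope.

(* Fix x, put psi g := f (T_g x) - (alpha + beta) / 2 and let E be the set of the h
   in a large Folner set Q for which the averages of psi over the tiles F_n h
   fluctuate N times.  By transference it suffices to show that |E| / |Q| decays
   exponentially in N.

   Given a finite set U and, for each y in U, k indices n, take the tiles F_n y
   greedily, by decreasing n, keeping those almost disjoint from the previous ones.
   Left temperedness says that the points whose smaller tiles meet F_n y form a set
   K_n y hardly larger than F_n y.  Hence, for k large, the union W of the chosen
   tiles either is twice as large as U or covers almost all of U.

   Split the fluctuations into blocks of 2k and iterate from U = E, using in turn
   upper and lower indices.  A point y of a tile F_i h with h in E may use the later
   indices of h: by right temperedness F_n y and F_n h almost coincide when i < n,
   so W can be cut down to tiles centered in E and no part of the gap is lost.  The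
   sum of psi is at least c|U| on U and at most -c|W| on W; since W almost covers U
   and psi is bounded, |W| >= (1 + delta)|U|.  After J blocks,
   |E| (1 + delta)^J <= 4 |Q|. *)

(** * Tiles *)

Section FsetSums.
Local Open Scope fset_scope.
Local Open Scope ring_scope.
Variables (R : realDomainType) (K : choiceType).
Implicit Types A B : {fset K}.

Lemma fset_sumD (f : K -> R) A B :
  \sum_(x <- A) f x = \sum_(x <- A `&` B) f x + \sum_(x <- A `\` B) f x.
Proof.
rewrite (big_fsetID _ (mem B)) /=; congr (_ + _); apply: eq_fbigl => x.
  by rewrite !inE.
by rewrite !inE /= andbC.
Qed.

Lemma fset_sumU (f : K -> R) A B : [disjoint A & B] ->
  \sum_(x <- A `|` B) f x = \sum_(x <- A) f x + \sum_(x <- B) f x.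
Proof.
move=> dAB; rewrite (fset_sumD f _ A); congr (_ + _).
  by rewrite fsetIC fsetKU.
by rewrite fsetDUl fsetDv fset0U (fsetDidPl _ _ _) // fdisjoint_sym.
Qed.

Lemma fset_sum_le_card (f : K -> R) (b : R) A : (forall x, `|f x| <= b) ->
  `|\sum_(x <- A) f x| <= b * #|` A|%:R.
Proof.
move=> fb; apply: le_trans (ler_norm_sum _ _ _) _.
rewrite card_fset_sum1 natr_sum mulr_sumr; apply: ler_sum => x _.
by rewrite mulr1.
Qed.

Lemma cardfsDR A B : #|` A|%:R = #|` A `&` B|%:R + #|` A `\` B|%:R :> R.
Proof. by rewrite -natrD cardfsID. Qed.

Lemma leq_card_fset A B : A `<=` B -> #|` A|%:R <= #|` B|%:R :> R.
Proof. by move=> /fsubset_leq_card; rewrite ler_nat. Qed.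

Lemma card_fsetU_le A B : #|` A `|` B|%:R <= #|` A|%:R + #|` B|%:R :> R.
Proof. by rewrite -natrD ler_nat; case: (leq_card_fsetU A B). Qed.

Lemma card_fsetU_disjoint A B : [disjoint A & B] ->
  #|` A `|` B|%:R = #|` A|%:R + #|` B|%:R :> R.
Proof.
by move=> d; rewrite -natrD; case: (leq_card_fsetU A B) => _; rewrite d => /eqP->.
Qed.

End FsetSums.

Definition rtile (G : groupType) (A : {fset G}) (y : G) : {fset G} :=
  [fset (a * y)%g | a in A]%fset.

Section Tiles.
Local Open Scope fset_scope.
Local Open Scope ring_scope.
Variables (G : groupType).
Implicit Types (A B U : {fset G}) (x y : G).

Lemma rtileP A y x : reflect (exists2 a, a \in A & x = (a * y)%g) (x \in rtile A y).
Proof. exact: imfsetP. Qed.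

Lemma mem_rtile A y x : (x \in rtile A y) = ((x * y^-1)%g \in A).
Proof.
apply/rtileP/idP => [[a aA ->]|h]; first by rewrite mulgK.
by exists (x * y^-1)%g => //; rewrite mulgVK.
Qed.

Lemma card_rtile A y : #|` rtile A y| = #|` A|.
Proof. by rewrite card_imfset //; exact: mulIg. Qed.

Lemma sum_rtile (R : nmodType) A y (f : G -> R) :
  \sum_(x <- rtile A y) f x = \sum_(a <- A) f (a * y)%g.
Proof. by rewrite big_imfset //= => a b _ _ /mulIg. Qed.

Lemma rtileS A B y : A `<=` B -> rtile A y `<=` rtile B y.
Proof.
by move=> AB; apply/fsubsetP => x; rewrite !mem_rtile; apply: (fsubsetP AB).
Qed.

(** Double counting: for a fixed [a] in [A], the map sending [y] to [a * y] is injective, so at most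
    [|B|] points go into [B]. *)
Lemma sum_card_rtileI A U B :
  (\sum_(y <- U) #|` rtile A y `&` B| <= #|` A| * #|` B|)%N.
Proof.
have cI y : #|` rtile A y `&` B| = (\sum_(a <- A) ((a * y)%g \in B))%N.
  rewrite (_ : _ `&` _ = rtile [fset a in A | (a * y)%g \in B] y).
    rewrite card_rtile card_fset_sum1 big_fset /= big_mkcond /=.
    by apply: eq_bigr => a _; case: (_ \in B).
  by apply/fsetP => x; rewrite !inE !mem_rtile !inE /= mulgVK.
under eq_bigr do rewrite cI.
rewrite exchange_big /= card_fset_sum1 big_distrl /=; apply: leq_sum => a _.
rewrite mul1n -[leqLHS]/(\sum_(y <- U) ((a * y)%g \in B : nat))%N.
have -> : (\sum_(y <- U) ((a * y)%g \in B : nat) =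
    #|` [fset (a * y)%g | y in [fset y in U | (a * y)%g \in B]]|)%N.
  rewrite card_imfset /=; last exact: mulgI.
  rewrite -/(#|` _|) card_fset_sum1 big_fset /= [RHS]big_mkcond /=.
  by apply: eq_bigr => y _; case: (_ \in B).
apply: fsubset_leq_card; apply/fsubsetP => x /imfsetP [y /=].
by rewrite !inE => /andP[_ ?] ->.
Qed.

End Tiles.

(** * Greedy packings *)

Section Packing.
Local Open Scope fset_scope.
Local Open Scope ring_scope.
Variables (R : realFieldType) (G : groupType).
(** [K n] plays the role of the union of the [F_i^-1 F_n] with [i < n]; [lev n y] says that the
    index [n] is available at [y], borrowed from [ctr y]. *)
Variables (F K : nat -> {fset G}) (eps : R).
Variables (U : {fset G}) (ctr : G -> G) (lev : nat -> pred G).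

Hypothesis eps_gt0 : 0 < eps.
Hypothesis eps_le : eps <= 2^-1.
Hypothesis F0 : forall n, F n != fset0.
Hypothesis KP : forall i n a b, (i < n)%N -> a \in F i -> b \in F n ->
  (a^-1 * b)%g \in K n.
Hypothesis FK : forall n y, lev n y -> F n `<=` K n.
Hypothesis card_K : forall n, #|` K n|%:R <= (1 + eps / 64) * #|` F n|%:R :> R.
Hypothesis ctrP : forall n y, y \in U -> lev n y ->
  #|` rtile (F n) y `\` rtile (F n) (ctr y)|%:R <= eps / 64 * #|` F n|%:R :> R.

Let cF_gt0 n : 0 < #|` F n|%:R :> R.
Proof. by rewrite ltr0n cardfs_gt0. Qed.

(* The part of the tile that is kept: [W] is what has already been covered, and
   intersecting with the tile of [ctr y] keeps the control on the sum of [psi]. *)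
Definition tile_part (W : {fset G}) n y :=
  (rtile (F n) y `&` rtile (F n) (ctr y)) `\` W.

(* The points of the hull [H] are discarded: their later, smaller tiles may meet [W]. *)
Inductive packing : {fset G} -> {fset G} -> Prop :=
| packing0 : packing fset0 fset0
| packingS W H n y : packing W H -> y \in U -> lev n y ->
    (1 - eps) * #|` F n|%:R <= #|` tile_part W n y|%:R ->
    packing (W `|` tile_part W n y) (H `|` rtile (K n) y).

Lemma tile_part_disjoint W n y : [disjoint W & tile_part W n y].
Proof.
rewrite fdisjoint_sym; apply/fdisjointP => x.
by rewrite !inE => /andP[].
Qed.

Lemma packing_sub W H : packing W H -> forall w, w \in W ->
  exists y n, [/\ y \in U, lev n y & w \in rtile (F n) (ctr y)].
Proof.
elim=> {W H} [w|W H n y _ IH yU ly _ w]; first by rewrite inE.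
rewrite inE => /orP[/IH//|]; rewrite !inE => /andP[_ /andP[_ wF]].
by exists y, n.
Qed.

(** The kept parts are disjoint, and each misses at most [eps |F_n|] points of the tile around
    [ctr y], which costs at most half of the lower bound. *)
Lemma packing_sum W H (psi : G -> R) (b gam : R) : packing W H ->
  (forall x, `|psi x| <= b) -> b * eps <= gam / 2 ->
  (forall n y, y \in U -> lev n y ->
     gam * #|` F n|%:R <= \sum_(x <- rtile (F n) (ctr y)) psi x) ->
  gam / 2 * #|` W|%:R <= \sum_(x <- W) psi x.
Proof.
move=> pWH psib beps avg; elim: pWH => {W H} [|W H n y _ IH yU ly cC].
  by rewrite cardfs0 mulr0 big_seq_fset0.
have b0 : 0 <= b by apply: le_trans (psib 1%g); rewrite normr_ge0.
have gam0 : 0 <= gam by have := mulr_ge0 b0 (ltW eps_gt0); lra.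
have dC := tile_part_disjoint W n y.
rewrite fset_sumU // card_fsetU_disjoint // mulrDr lerD //.
set C := tile_part W n y in cC dC *.
have CF : C `<=` rtile (F n) (ctr y).
  by apply/fsubsetP => x; rewrite !inE => /andP[_ /andP[]].
have := avg _ _ yU ly; rewrite (fset_sumD psi (rtile (F n) (ctr y)) C).
have -> : rtile (F n) (ctr y) `&` C = C by apply/fsetIidPr.
have := cardfsDR R (rtile (F n) (ctr y)) C.
have -> : rtile (F n) (ctr y) `&` C = C by apply/fsetIidPr.
rewrite card_rtile.
have := fset_sum_le_card (rtile (F n) (ctr y) `\` C) psib.
rewrite ler_norml => /andP[_].
move: (\sum_(x <- C) _) (\sum_(x <- _ `\` C) _) => s s'.
have f0 := cF_gt0 n; have := ler0n R #|` rtile (F n) (ctr y) `\` C|.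
move: (#|` _ `\` C|%:R) (#|` C|%:R : R) (#|` F n|%:R : R) cC f0.
move=> d c f cC f0 d0 s'd fcd avgn.
have bd : b * d <= b * (eps * f) by apply: ler_wpM2l => //; lra.
have : gam / 2 * c <= gam / 2 * f.
  by apply: ler_wpM2l; lra.
have : b * eps * f <= gam / 2 * f by apply: ler_wpM2r => //; lra.
lra.
Qed.

(** Each step enlarges [H \ W] at most by [K_n y \ F_n y] and [F_n y \ F_n (ctr y)], together
    [eps |F_n| / 32] points, while [W] gains at least [|F_n| / 2]. *)
Lemma packing_hull W H : packing W H ->
  #|` H `\` W|%:R <= eps / 16 * #|` W|%:R :> R.
Proof.
elim=> {W H} [|W H n y _ IH yU ly cC].
  by rewrite fset0D cardfs0 mulr0.
have dC := tile_part_disjoint W n y.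
rewrite card_fsetU_disjoint //; set C := tile_part W n y in cC dC *.
have sub : (H `|` rtile (K n) y) `\` (W `|` C) `<=` (H `\` W) `|`
    ((rtile (K n) y `\` rtile (F n) y) `|` (rtile (F n) y `\` rtile (F n) (ctr y))).
  apply/fsubsetP => x; rewrite !inE.
  by do !case: (x \in _).
have c1 : #|` rtile (K n) y `\` rtile (F n) y|%:R <= eps / 64 * #|` F n|%:R :> R.
  have := cardfsDR R (rtile (K n) y) (rtile (F n) y).
  rewrite (fsetIidPr _); last exact/rtileS/FK/ly.
  by rewrite !card_rtile; have := card_K n; lra.
have := leq_card_fset R sub.
have := card_fsetU_le R (H `\` W) ((rtile (K n) y `\` rtile (F n) y)
  `|` (rtile (F n) y `\` rtile (F n) (ctr y))).
have := card_fsetU_le R (rtile (K n) y `\` rtile (F n) y)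
  (rtile (F n) y `\` rtile (F n) (ctr y)).
have := ctrP yU ly; have f0 := cF_gt0 n.
have : eps * ((1 - eps) * #|` F n|%:R) <= eps * #|` C|%:R by rewrite ler_wpM2l // ltW.
have : eps * (eps * #|` F n|%:R) <= eps * (2^-1 * #|` F n|%:R).
  by rewrite ler_wpM2l ?(ltW eps_gt0) // ler_wpM2r // ltW.
lra.
Qed.

Definition separated n (W H : {fset G}) :=
  forall m y, (m < n)%N -> y \notin H -> [disjoint rtile (F m) y & W].

(** If [F_i z] meets [F_m y] with [i < m], say [a z = b y], then [z = a^-1 b y] lies in [K_m y],
    which has just been discarded. *)
Lemma separatedS n m W H y : separated n W H -> (n <= m)%N ->
  separated n (W `|` tile_part W m y) (H `|` rtile (K m) y).
Proof.
move=> sep nm i z lin; rewrite inE negb_or => /andP[zH zK].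
rewrite fdisjointXU sep //=; apply/fdisjointP => x.
rewrite mem_rtile !inE => xz; apply: contra zK => /andP[_ /andP[xy _]].
rewrite mem_rtile; rewrite mem_rtile in xy.
have := KP (leq_trans lin nm) xz xy.
by rewrite invgM invgK -!mulgA mulKg.
Qed.

(** Scan the list, keeping a tile whenever its new part is large enough. A rejected tile nearly
    coincides with the one around [ctr y], so more than [eps / 2] of it is already covered. *)
Lemma packing_level_seq n W H (l : seq G) : packing W H -> separated n W H ->
  {subset l <= U} -> all (lev n) l ->
  exists W' H', [/\ packing W' H', separated n W' H', W `<=` W', H `<=` H' &
    forall y, y \in l -> eps / 2 * #|` F n|%:R <= #|` rtile (F n) y `&` W'|%:R :> R].
Proof.
move=> pWH sep; elim: l => [_ _|y l IH lU /= /andP[ly ll]].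
  by exists W, H.
have [|W' [H' [p' s' sW sH c']]] := IH _ ll.
  by move=> z zl; apply: lU; rewrite inE zl orbT.
have yU : y \in U by apply: lU; rewrite inE eqxx.
have f0 := cF_gt0 n.
have e2 : eps * #|` F n|%:R <= 2^-1 * #|` F n|%:R by rewrite ler_wpM2r // ltW.
have [le|gt] := lerP ((1 - eps) * #|` F n|%:R) #|` tile_part W' n y|%:R.
  exists (W' `|` tile_part W' n y), (H' `|` rtile (K n) y); split.
  - exact: packingS.
  - exact: separatedS.
  - exact: fsubset_trans sW (fsubsetUl _ _).
  - exact: fsubset_trans sH (fsubsetUl _ _).
  move=> z; rewrite inE => /orP[/eqP->|/c' cz].
    have : tile_part W' n y `<=` rtile (F n) y `&` (W' `|` tile_part W' n y).
      apply/fsubsetP => x; rewrite !inE.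
      by do !case: (x \in _).
    by move=> /(leq_card_fset R); lra.
  apply: le_trans cz (leq_card_fset _ _).
  exact/fsetIS/fsubsetUl.
exists W', H'; split=> // z; rewrite inE => /orP[/eqP->|/c' //].
have := cardfsDR R (rtile (F n) y) (rtile (F n) (ctr y)).
have := cardfsDR R (rtile (F n) y `&` rtile (F n) (ctr y)) W'.
have : (rtile (F n) y `&` rtile (F n) (ctr y)) `&` W' `<=` rtile (F n) y `&` W'.
  by apply: fsetSI; exact: fsubsetIl.
move=> /(leq_card_fset R); rewrite card_rtile.
have := ctrP yU ly; have := mulr_gt0 eps_gt0 f0.
move: gt; rewrite /tile_part; lra.
Qed.

(** By separation, tiles of level [n] centered outside the old hull miss [W], so a share [eps / 2]
    of each lies in [W' \ W]; double counting then bounds the number of centers. *)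
Lemma packing_level n W H : packing W H -> separated n.+1 W H ->
  exists W' H', [/\ packing W' H', separated n W' H', H `<=` H' &
    #|` W|%:R + eps / 2 * #|` [fset y in U `\` H' | lev n y]|%:R <= #|` W'|%:R :> R].
Proof.
move=> pWH sep; pose Y := [fset y in U `\` H | lev n y].
have [||| W' [H' [p' s' sW sH hY]]] := @packing_level_seq n W H Y pWH.
- by move=> m y /ltnW mn; apply: sep.
- by move=> y; rewrite !inE => /andP[/andP[_ ->]].
- by apply/allP => y; rewrite !inE => /andP[].
exists W', H'; split => //.
have f0 := cF_gt0 n.
have := cardfsDR R W' W; rewrite (fsetIidPr _) // => ->; rewrite lerD2l.
have YY : [fset y in U `\` H' | lev n y] `<=` Y.
  apply/fsubsetP => y; rewrite !inE => /andP[/andP[yH ->] ->].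
  by rewrite !andbT; apply: contra yH; apply: (fsubsetP sH).
apply: (@le_trans _ _ (eps / 2 * #|` Y|%:R)).
  by rewrite ler_wpM2l ?leq_card_fset // divr_ge0 // ltW.
rewrite -(ler_pM2l f0).
have := sum_card_rtileI (F n) Y (W' `\` W).
rewrite -(ler_nat R) natr_sum natrM; apply: le_trans.
rewrite [X in _ / _ * X%:R]card_fset_sum1 natr_sum mulrA mulr_sumr.
rewrite big_seq [leRHS]big_seq; apply: ler_sum => y yY.
rewrite mulr1 mulrC; apply: le_trans (hY _ yY) (leq_card_fset _ _).
have /fdisjointP dW : [disjoint rtile (F n) y & W].
  by apply: sep => //; move: yY; rewrite !inE => /andP[/andP[]].
apply/fsubsetP => x; rewrite !inE => /andP[xF ->].
by rewrite xF (dW _ xF).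
Qed.

(** Levels are treated from [n + d - 1] down to [n]. Hulls only grow, so the counts from higher
    levels stay valid for the final [H]. *)
Lemma packing_down n d :
  exists W H, [/\ packing W H, separated n W H &
    eps / 2 * (\sum_(n <= m < n + d) #|` [fset y in U `\` H | lev m y]|%:R)
      <= #|` W|%:R :> R].
Proof.
elim: d n => [|d IH] n.
  rewrite addn0; exists fset0, fset0; split=> [|m y _ _|].
  - exact: packing0.
  - exact: fdisjointX0.
  - by rewrite big_geq // mulr0 cardfs0.
have [W [H [pWH sWH cW]]] := IH n.+1.
have [W' [H' [p' s' sH cW']]] := packing_level pWH sWH.
exists W', H'; split=> //; apply: le_trans cW'; rewrite addnC.
rewrite big_ltn ?addSn ?ltnS ?leq_addl // mulrDr addrC lerD2r.
apply: le_trans cW; rewrite ler_wpM2l ?divr_ge0 ?(ltW eps_gt0) //.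
rewrite addSn addnC; apply: ler_sum => m _; apply: leq_card_fset.
apply/fsubsetP => y; rewrite !inE => /andP[/andP[yH ->] ->].
by rewrite !andbT; apply: contra yH; apply: (fsubsetP sH).
Qed.

(** Each point of [U \ H] is counted at [k] levels or more, so [eps k |U \ H| / 2 <= |W|]. If
    [|W| < 2 |U|], the size of [k] forces [|U \ H| <= eps |U| / 8], and [H \ W] adds at most as much
    again. *)
Lemma packing_exists (L k : nat) :
  (forall y, y \in U -> (k <= \sum_(m < L) lev m y)%N) ->
  32 <= eps ^+ 2 * k%:R ->
  exists W H, packing W H /\
    (2 * #|` U|%:R <= #|` W|%:R :> R \/
     #|` U `\` W|%:R <= eps / 4 * #|` U|%:R :> R).
Proof.
move=> kP k32; have [W [H [pWH _ cW]]] := packing_down 0 L.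
exists W, H; split=> //.
have [|ltW2] := lerP (2 * #|` U|%:R : R) #|` W|%:R; [by left | right].
have cUH : eps / 2 * (k%:R * #|` U `\` H|%:R) <= #|` W|%:R.
  apply: le_trans cW; rewrite ler_wpM2l ?divr_ge0 ?(ltW eps_gt0) //.
  rewrite card_fset_sum1 -natr_sum -natrM ler_nat big_distrr /=.
  under [leqRHS]eq_bigr => m _ do rewrite card_fset_sum1 big_fset /= big_mkcond /=.
  rewrite exchange_big /= big_seq [leqRHS]big_seq; apply: leq_sum => y.
  rewrite inE => /andP[_ yU]; rewrite muln1 add0n big_mkord.
  apply: leq_trans (kP y yU) _; apply: leq_sum => m _.
  by case: (lev m y).
have cH := packing_hull pWH.
have sub : U `\` W `<=` (U `\` H) `|` (H `\` W).
  apply/fsubsetP => x; rewrite !inE.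
  by do !case: (x \in _).
have := le_trans (leq_card_fset R sub) (card_fsetU_le R _ _).
have e8 : eps / 16 * #|` W|%:R <= eps / 16 * (2 * #|` U|%:R).
  by rewrite ler_wpM2l ?divr_ge0 ?(ltW eps_gt0) // ltW.
suff : #|` U `\` H|%:R <= eps / 8 * #|` U|%:R :> R by lra.
have := ler_wpM2r (ler0n R #|` U `\` H|) k32 => k32'.
rewrite -(@ler_pM2l _ 32) //; apply: le_trans k32' _.
have : eps * (eps / 2 * (k%:R * #|` U `\` H|%:R)) <= eps * (2 * #|` U|%:R).
  by rewrite ler_wpM2l ?(ltW eps_gt0) //; lra.
rewrite expr2; lra.
Qed.

End Packing.

(** * Growth along alternating blocks *)

Lemma size_le_sum_mem (s : seq nat) (L : nat) : uniq s ->
  all (fun m => m < L)%N s -> (size s <= \sum_(m < L) ((m : nat) \in s))%N.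
Proof.
move=> us sL; rewrite -(big_mkord xpredT (fun m => (m \in s) : nat)) /=.
rewrite -big_mkcond /= sum1_count -size_filter.
apply: uniq_leq_size => // m ms.
by rewrite mem_filter ms mem_index_iota (allP sL).
Qed.

Section Growth.
Local Open Scope fset_scope.
Local Open Scope ring_scope.

(** Adding the two sum bounds cancels the common part of [U] and [W] and leaves
    [eps (|U| + |W|) <= |U \ W| + |W \ U|]. If [U \ W] is small, [W \ U] must be large. *)
Lemma alternating_growth (R : realFieldType) (G : choiceType) (psi : G -> R) (b eps : R)
    (U W : {fset G}) : 0 < b -> 0 < eps -> eps <= 2^-1 ->
  (forall x, `|psi x| <= b) ->
  b * eps * #|` U|%:R <= \sum_(x <- U) psi x ->
  b * eps * #|` W|%:R <= - \sum_(x <- W) psi x ->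
  2 * #|` U|%:R <= #|` W|%:R :> R \/
    #|` U `\` W|%:R <= eps / 4 * #|` U|%:R :> R ->
  (1 + eps / 2) * #|` U|%:R <= #|` W|%:R :> R.
Proof.
move=> b0 e0 e2 psib sU sW [le2|leD].
  by apply: le_trans le2; rewrite ler_wpM2r //; lra.
have := fset_sum_le_card (U `\` W) psib; rewrite ler_norml => /andP[_ sUW].
have := fset_sum_le_card (W `\` U) psib; rewrite ler_norml => /andP[sWU _].
move: sU sW; rewrite (fset_sumD psi U W) (fset_sumD psi W U) fsetIC => sU sW.
have cU := cardfsDR R U W; have := cardfsDR R W U; rewrite fsetIC => cW.
have : b * (eps * (#|` U|%:R + #|` W|%:R)) <= b * (#|` U `\` W|%:R + #|` W `\` U|%:R).
  lra.
rewrite ler_pM2l // => h.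
have : 0 <= eps * #|` W|%:R by rewrite mulr_ge0 // ltW.
lra.
Qed.

End Growth.

Section Blocks.
Local Open Scope fset_scope.
Local Open Scope ring_scope.
Variables (R : realFieldType) (G : groupType).
(** [K] and [K'] play the roles of the left and right hulls. The indices [t h i] are counted from
    [i = 0], so averages are low at even [i] and high at odd [i]; hence the sign in [t_sum]. *)
Variables (F K K' : nat -> {fset G}) (eps b : R) (psi : G -> R).
Variables (E Q : {fset G}) (t : G -> nat -> nat) (N L k : nat).

Hypothesis eps_gt0 : 0 < eps.
Hypothesis eps_le : eps <= 2^-1.
Hypothesis b_gt0 : 0 < b.
Hypothesis psib : forall x, `|psi x| <= b.
Hypothesis k_ge : 32 <= eps ^+ 2 * k%:R.
Hypothesis F0 : forall n, F n != fset0.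
Hypothesis KP : forall i n x y, (i < n)%N -> x \in F i -> y \in F n ->
  (x^-1 * y)%g \in K n.
Hypothesis K'P : forall i n x y, (i < n)%N -> x \in F i -> y \in F n ->
  (y * x^-1)%g \in K' n.
Hypothesis one_F0 : 1%g \in F 0%N.
Hypothesis card_K : forall n, #|` K n|%:R <= (1 + eps / 64) * #|` F n|%:R :> R.
Hypothesis card_K' : forall n, #|` K' n|%:R <= (1 + eps / 64) * #|` F n|%:R :> R.
Hypothesis t_lt : forall h i j, h \in E -> (i < j < 2 * N)%N -> (t h i < t h j)%N.
Hypothesis t_ltL : forall h i, h \in E -> (i < 2 * N)%N -> (t h i < L)%N.
Hypothesis t_sum : forall h i, h \in E -> (i < 2 * N)%N ->
  2 * b * eps * #|` F (t h i)|%:R <=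
  \sum_(x <- rtile (F (t h i)) h) (-1) ^+ i.+1 * psi x.
Hypothesis tile_Q : forall h i, h \in E -> (i < 2 * N)%N ->
  rtile (F (t h i)) h `<=` Q.
Hypothesis card_EQ : (#|` E| <= #|` Q|)%N.

Let F_sub_K n : (0 < n)%N -> F n `<=` K n.
Proof.
move=> n0; apply/fsubsetP => y yF.
by have := KP n0 one_F0 yF; rewrite invg1 mul1g.
Qed.

Let F_sub_K' n : (0 < n)%N -> F n `<=` K' n.
Proof.
move=> n0; apply/fsubsetP => y yF.
by have := K'P n0 one_F0 yF; rewrite invg1 mulg1.
Qed.

(* Right temperedness: both tiles lie in [rtile (K' n) w], which is hardly larger. *)
Lemma rtile_shift m n h w : (m < n)%N -> w \in rtile (F m) h ->
  #|` rtile (F n) w `\` rtile (F n) h|%:R <= eps / 64 * #|` F n|%:R :> R.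
Proof.
move=> mn wF.
have hK : rtile (F n) h `<=` rtile (K' n) w.
  apply/fsubsetP => x; rewrite !mem_rtile => xF.
  rewrite mem_rtile in wF; have := K'P mn wF xF.
  by rewrite invgM invgK mulgA mulgVK.
have wK : rtile (F n) w `<=` rtile (K' n) w.
  by apply/rtileS/F_sub_K'; case: n mn {hK}.
have := leq_card_fset R (fsetSD (rtile (F n) h) wK).
have := cardfsDR R (rtile (K' n) w) (rtile (F n) h).
rewrite (fsetIidPr _) // !card_rtile.
by have := card_K' n; lra.
Qed.

(** What survives after [j] blocks of [2 k] indices: [y] can stand in for [ctr y] at all later
    indices. *)
Definition centered j (U : {fset G}) (ctr : G -> G) :=
  forall y, y \in U -> ctr y \in E /\
  forall i, (2 * k * j < i < 2 * N)%N ->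
    #|` rtile (F (t (ctr y) i)) y `\` rtile (F (t (ctr y) i)) (ctr y)|%:R
      <= eps / 64 * #|` F (t (ctr y) i)|%:R :> R.

(** The packing uses [k] indices of one parity in the next block. Each point of [W] lies in a tile
    centered in [E] with index in this block, so [rtile_shift] lets it borrow all indices beyond the
    block. *)
Lemma centered_step j U ctr : (k * j.+1 < N)%N -> centered j U ctr ->
  exists W ctr', [/\ centered j.+1 W ctr', W `<=` Q,
    b * eps * #|` W|%:R <= (-1) ^+ j * \sum_(x <- W) psi x &
    2 * #|` U|%:R <= #|` W|%:R :> R \/
    #|` U `\` W|%:R <= eps / 4 * #|` U|%:R :> R].
Proof.
move=> kjN cU.
(* Index [0] is skipped: [t h i] is only known to be positive for [0 < i]. *)
pose idx q := (2 * k * j + 1 + 2 * q + odd j)%N.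
have idxP q : (q < k)%N -> (2 * k * j < idx q <= 2 * k * j.+1)%N.
  by rewrite /idx => qk; case: (odd j) => /=; nia.
have kjN2 : (2 * k * j.+1 < 2 * N)%N by nia.
have idxN q : (q < k)%N -> (idx q < 2 * N)%N.
  by move=> /idxP; lia.
have idx_sign q : (-1) ^+ (idx q).+1 = (-1) ^+ j :> R.
  rewrite -signr_odd -[RHS]signr_odd /idx /= !oddD !oddM /=.
  by rewrite oddb; case: (odd j); case: (odd q).
(* Membership in [U] is built in because [F n] must lie in [K n] whenever [lev n y] holds, which
   relies on [ctr y] being in [E]. *)
pose lev n y := (n \in [seq t (ctr y) (idx q) | q <- iota 0 k]) && (y \in U).
have levP n y : y \in U -> lev n y -> exists2 q, (q < k)%N & n = t (ctr y) (idx q).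
  by move=> yU /andP[/mapP[q]]; rewrite mem_iota add0n => /= qk -> _; exists q.
have [|||W [H [pWH dich]]] := @packing_exists R G F K eps U ctr lev eps_gt0
    eps_le F0 KP _ card_K _ L k _ k_ge.
- move=> n y /[dup] /andP[_ yU] /(levP _ _ yU)[q qk ->]; apply: F_sub_K.
  have [hE _] := cU _ yU; have := @t_lt _ 0 (idx q) hE.
  by have := idxP _ qk; have := idxN _ qk; lia.
- move=> n y yU /(levP _ _ yU)[q qk ->]; have [_] := cU _ yU; apply.
  by have := idxP _ qk; have := idxN _ qk; lia.
- move=> y yU; have [hE _] := cU _ yU.
  under eq_bigr do rewrite /lev yU andbT.
  apply: leq_trans (size_le_sum_mem _ _); first by rewrite size_map size_iota.
    rewrite map_inj_in_uniq ?iota_uniq // => p q.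
    rewrite !mem_iota !add0n => /= pk qk; wlog pq : p q pk qk / (p <= q)%N.
      by move=> W; case/orP: (leq_total p q) => pq; [|move/esym]; move/W => ->.
    move: pq; rewrite leq_eqVlt => /orP[/eqP//|pq] tE.
    have : (t (ctr y) (idx p) < t (ctr y) (idx q))%N.
      by apply: t_lt => //; rewrite idxN // andbT /idx; lia.
    by rewrite tE ltnn.
  apply/allP => m /mapP[q]; rewrite mem_iota add0n => /= qk ->.
  by apply: t_ltL => //; apply: idxN.
(* The new center of [w] is some [ctr y] whose tile, at a level of [y], contains [w]; outside [W]
   the value [1] is a dummy. *)
have ctrW w : exists h, w \in W -> h \in E /\
    exists2 q, (q < k)%N & w \in rtile (F (t h (idx q))) h.
  have [wW|] := boolP (w \in W); last by exists 1%g.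
  have [y [n [yU ly wF]]] := packing_sub pWH wW.
  have [hE _] := cU _ yU; have [q qk nE] := levP _ _ yU ly.
  by exists (ctr y) => _; split=> //; exists q; rewrite -?nE.
have [ctr' ctr'P] := choice ctrW.
exists W, ctr'; split=> //.
- move=> w /ctr'P[hE [q qk wF]]; split=> // i iN.
  apply: rtile_shift wF; apply: t_lt => //.
  by have := idxP _ qk; lia.
- apply/fsubsetP => w /ctr'P[hE [q qk]]; apply/fsubsetP/tile_Q => //.
  exact: idxN.
(* With [gam = 2 b eps] the permitted loss [b eps] is exactly [gam / 2]. *)
- have := @packing_sum _ _ _ _ _ _ _ _ eps_gt0 F0 W H
    (fun x => (-1) ^+ j * psi x) b (2 * b * eps) pWH _ _ _.
  rewrite -mulr_sumr (_ : 2 * b * eps / 2 = b * eps); last by field.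
  apply => //; first by move=> x; rewrite normrM normrX normrN1 expr1n mul1r.
  move=> n y yU /(levP _ _ yU)[q qk ->]; have [hE _] := cU _ yU.
  apply: le_trans (t_sum hE (idxN _ qk)) _.
  by rewrite idx_sign.
Qed.

Lemma card_fluctuation J : (k * J < N)%N ->
  (1 + eps / 2) ^+ J * #|` E|%:R <= 4 * #|` Q|%:R :> R.
Proof.
have EQ : #|` E|%:R <= #|` Q|%:R :> R by rewrite ler_nat.
have Q0 : 0 <= #|` Q|%:R :> R by [].
case: J => [_|J kJ]; first by rewrite expr0 mul1r; lra.
have e_gt0 := eps_gt0; have e_le := eps_le.
have e1 : 1 + eps / 2 <= 2 by lra.
have e2 : eps / 4 <= 2^-1 by lra.
suff [U [ctr [_ UQ _ cU]]] : exists U ctr, [/\ centered J.+1 U ctr, U `<=` Q,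
    b * eps * #|` U|%:R <= (-1) ^+ J * \sum_(x <- U) psi x &
    (1 + eps / 2) ^+ J.+1 * #|` E|%:R <= 4 * #|` U|%:R :> R].
  by apply: le_trans cU _; rewrite ler_pM2l // leq_card_fset.
elim: J kJ => [|J IH] kJ.
  (* Nothing is known about the sum of [psi] over [E], so the first block only yields
     [|W| >= |E| / 2]; with [1 + eps / 2 <= 2] this accounts for the factor [4]. All later blocks
     give true growth. *)
  have [|W [ctr [cW WQ sW dich]]] := @centered_step 0 E id kJ.
    move=> y yE; split=> // i _; rewrite fsetDv cardfs0.
    by rewrite mulr_ge0 // divr_ge0 // ltW.
  exists W, ctr; split=> //.
  have le : (1 + eps / 2) * #|` E|%:R <= 2 * #|` E|%:R :> R by rewrite ler_wpM2r.
  have le' : eps / 4 * #|` E|%:R <= 2^-1 * #|` E|%:R :> R by rewrite ler_wpM2r.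
  rewrite expr1; have W0 : 0 <= #|` W|%:R :> R by [].
  case: dich => [|D]; first by lra.
  have := cardfsDR R E W; have := leq_card_fset R (fsubsetIr E W); lra.
have [|U [ctr [cU UQ sU card_U]]] := IH; first by nia.
have [W [ctr' [cW WQ sW dich]]] := centered_step kJ cU.
exists W, ctr'; split=> //.
have := @alternating_growth _ _ (fun x => (-1) ^+ J * psi x) b eps U W b_gt0 eps_gt0 eps_le.
rewrite -!mulr_sumr => /(_ _ sU _ dich) gr.
rewrite exprS -mulrA.
apply: (@le_trans _ _ ((1 + eps / 2) * (4 * #|` U|%:R))).
  by rewrite ler_wpM2l //; lra.
rewrite mulrCA ler_pM2l //; apply: gr.
  by move=> x; rewrite normrM normrX normrN1 expr1n mul1r.
by move: sW; rewrite exprS mulN1r mulNr.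
Qed.

End Blocks.

(** * Bi-tempered sequences *)

Section Tempered.
Variables (R : realType) (G : groupType).
Local Open Scope fset_scope.
Local Open Scope ring_scope.

Lemma rtile_rtile (A : {fset G}) x y : rtile (rtile A x) y = rtile A (x * y)%g.
Proof. by apply/fsetP => z; rewrite !mem_rtile invgM mulgA. Qed.

(** Translating [F] by [g^-1] leaves each [F_n F_i^-1] unchanged and conjugates [F_i^-1 F_n] by [g],
    so the temperedness bounds persist; replacing [h] by [g * h] preserves the tiles. *)
Lemma card_fluctuation_bi_tempered (F : nat -> {fset G}) (eps b : R)
    (psi : G -> R) (E Q : {fset G}) (t : G -> nat -> nat) (N L k J : nat) :
  0 < eps -> eps <= 2^-1 -> 0 < b -> (forall x, `|psi x| <= b) ->
  32 <= eps ^+ 2 * k%:R ->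
  (forall n, F n != fset0) -> bi_tempered (1 + eps / 64) F ->
  (forall h i j, h \in E -> (i < j < 2 * N)%N -> (t h i < t h j)%N) ->
  (forall h i, h \in E -> (i < 2 * N)%N ->
    [/\ (t h i < L)%N, rtile (F (t h i)) h `<=` Q &
    2 * b * eps * #|` F (t h i)|%:R <=
      \sum_(x <- rtile (F (t h i)) h) (-1) ^+ i.+1 * psi x]) ->
  (#|` E| <= #|` Q|)%N -> (k * J < N)%N ->
  (1 + eps / 2) ^+ J * #|` E|%:R <= 4 * #|` Q|%:R :> R.
Proof.
move=> e0 e2 b0 psib k32 F0 [lF rF] t_lt tP EQ kJN.
have /fset0Pn[g gF] := F0 0%N.
(* After this translation [1 \in F' 0], so each [F' n] lies in its hulls. *)
pose F' n := rtile (F n) g^-1.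
have cF' n : #|` F' n| = #|` F n| by exact: card_rtile.
pose K n := rtile [fset (g * x)%g | x in
  \bigcup_(i <- iota 0 n) fset_mul (fset_inv (F i)) (F n)] g^-1.
pose K' n := \bigcup_(i <- iota 0 n) fset_mul (F n) (fset_inv (F i)).
pose E' := [fset (g * h)%g | h in E].
have cE' : #|` E'| = #|` E| by rewrite card_imfset //; exact: mulgI.
have E'P h : h \in E' -> (g^-1 * h)%g \in E.
  by move=> /imfsetP[x xE ->]; rewrite mulKg.
have F'E n h : rtile (F' n) h = rtile (F n) (g^-1 * h)%g by exact: rtile_rtile.
rewrite -cE'; apply: (@card_fluctuation R G F' K K' eps b psi E' Q
  (fun h => t (g^-1 * h)%g) N L k) => //.
- by move=> n; rewrite -cardfs_gt0 cF' cardfs_gt0.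
- move=> i n x y lin; rewrite !mem_rtile !invgK => xF yF.
  apply/imfsetP; exists ((x * g)^-1 * (y * g))%g => /=; last first.
    by rewrite invgM !mulgA mulgV mul1g.
  apply/bigfcupP; exists i; first by rewrite mem_iota lin.
  apply/imfset2P; exists (x * g)^-1%g; first by apply/imfsetP; exists (x * g)%g.
  by exists (y * g)%g.
- move=> i n x y lin; rewrite !mem_rtile !invgK => xF yF.
  apply/bigfcupP; exists i; first by rewrite mem_iota lin.
  apply/imfset2P; exists (y * g)%g => //.
  exists (x * g)^-1%g; first by apply/imfsetP; exists (x * g)%g.
  by rewrite invgM mulgA mulgK.
- by rewrite mem_rtile invgK mul1g.
- move=> n; rewrite cF' card_rtile; apply: le_trans (lF n).
  by rewrite ler_nat leq_imfset_card.
- by move=> n; rewrite cF'; exact: rF.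
- by move=> h i j /E'P hE; exact: t_lt.
- by move=> h i /E'P hE iN; have [] := tP _ _ hE iN.
- by move=> h i /E'P hE iN; rewrite cF' F'E; have [] := tP _ _ hE iN.
- by move=> h i /E'P hE iN; rewrite F'E; have [] := tP _ _ hE iN.
- by rewrite cE'.
Qed.

End Tempered.

(** * Transference *)

(** Positions start at [0], so low values sit at even ones. The bound [L] leaves finitely many [F_n]
    in play, as transference requires. *)
Definition fluctuates_before (R : realType) (alpha beta : R) (N L : nat)
    (a : nat -> R) : Prop :=
  exists t : nat -> nat,
    (forall i j, (i < j < 2 * N)%N -> (t i < t j)%N) /\
    (forall i, (i < 2 * N)%N -> (t i < L)%N /\
       if odd i then beta <= a (t i) else a (t i) <= alpha).

Section Transference.
Variables (R : realType) (G : groupType).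
Local Open Scope fset_scope.
Local Open Scope ring_scope.

(** For each [g], left multiplication by [g] sends the bad [h] injectively into [g F_m \ F_m]; the
    bounds for the elements of [s] add up. *)
Lemma folner_near (F : nat -> {fset G}) (s : seq G) (e : R) : folner R F -> 0 < e ->
  \forall m \near \oo,
    #|` [fset h in F m | ~~ all (fun g => (g * h)%g \in F m) s]|%:R
      <= (size s)%:R * e * #|` F m|%:R.
Proof.
move=> [F0 Flim] e0; elim: s => [|g s IH].
  near=> m; rewrite !mul0r (_ : [fset _ in _ | _] = fset0) ?cardfs0 //.
  by apply/fsetP => h; rewrite !inE /= andbF.
have := Flim g => /cvgrPdist_le /(_ _ e0) gF.
near=> m.
have c0 : 0 < #|` F m|%:R :> R by rewrite ltr0n cardfs_gt0.
have : `|0 - #|` fset_symdiff (fset_lmul g (F m)) (F m)|%:R / #|` F m|%:R| <= e.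
  by near: m.
rewrite sub0r normrN ger0_norm ?divr_ge0 // ler_pdivrMr // => gm.
have sm : #|` [fset h in F m | ~~ all (fun g => (g * h)%g \in F m) s]|%:R
  <= (size s)%:R * e * #|` F m|%:R by near: m.
have gm' : #|` [fset h in F m | (g * h)%g \notin F m]|%:R <= e * #|` F m|%:R.
  apply: le_trans gm; rewrite ler_nat; set B := [fset _ in _ | _].
  have <- : #|` fset_lmul g B| = #|` B| by rewrite card_imfset //; exact: mulgI.
  apply: fsubset_leq_card; apply/fsubsetP => x /imfsetP[y /= + ->].
  rewrite !inE /= => /andP[yF gyF]; rewrite gyF orbC /=.
  by apply/orP; right; apply/imfsetP; exists y.
have -> : (size (g :: s))%:R * e * #|` F m|%:R =
  e * #|` F m|%:R + (size s)%:R * e * #|` F m|%:R :> R by rewrite /= -natr1; ring.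
apply: le_trans (lerD gm' sm); apply: le_trans (card_fsetU_le R _ _).
apply: leq_card_fset; apply/fsubsetP => h; rewrite !inE /= negb_and.
by case: (h \in F m).
Unshelve. all: by end_near. Qed.

Lemma folner_interior (F : nat -> {fset G}) (K : {fset G}) (e : R) : folner R F -> 0 < e ->
  exists2 Q : {fset G}, Q != fset0 &
    (1 - e) * #|` Q|%:R <= #|` [fset h in Q | rtile K h `<=` Q]|%:R.
Proof.
(* The tolerance [e] is shared among the elements of [K]; the successor keeps the denominator
   nonzero when [K] is empty. *)
move=> hF e0; have e0' : 0 < e / (#|` K|.+1)%:R by rewrite divr_gt0.
have [m _ /(_ m (leqnn m))] := folner_near K hF e0' => /=.
rewrite -[size K]/(#|` K|); set B := [fset _ in _ | _] => hm.
exists (F m); first exact: (hF.1 m).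
have le : #|` K|%:R * (e / (#|` K|.+1)%:R) <= e.
  by rewrite mulrCA ler_piMr ?(ltW e0) // ler_pdivrMr // mul1r ler_nat.
have := ler_wpM2r (ler0n R #|` F m|) le.
have := cardfsDR R (F m) [fset h in F m | rtile K h `<=` F m].
rewrite (fsetIidPr _); last by apply/fsubsetP => h; rewrite !inE => /andP[].
rewrite (_ : F m `\` _ = B); first by move: (_ * (e / _)) hm => c hm; lra.
apply/fsetP => h; rewrite !inE /= andbC; case: (h \in F m) => //=.
congr (~~ _); apply/fsubsetP/allP => [sub g gK|al x /rtileP[a aK ->]].
  by apply: sub; apply/rtileP; exists g.
exact: al.
Qed.

(** Integrate over [x] the number of [h] in the interior [Q'] of [Q] with [T h x] in [D]. By
    invariance this gives [|Q'| mu D], pointwise the count is at most [kap |Q|], and [|Q'| / |Q|]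
    can be made arbitrarily close to [1]. *)
Lemma transference (F : nat -> {fset G}) (d : measure_display) (X : measurableType d)
    (mu : probability X R) (T : G -> X -> X) (D : set X) (K : {fset G}) (kap : R) :
  folner R F -> mp_action mu T -> measurable D ->
  (forall Q x, #|` [fset h in Q | (rtile K h `<=` Q) && `[< D (T h x) >]]|%:R
     <= kap * #|` Q|%:R) ->
  (mu D <= kap%:E)%E.
Proof.
move=> hF [T1 TM mT muT] mD hD.
have fD : mu D \is a fin_num by exact: fin_num_measure.
rewrite -(fineK fD) lee_fin; set p := fine (mu D).
have p0 : 0 <= p by rewrite fine_ge0.
have p1 : p <= 1 by rewrite -lee_fin fineK // probability_le1.
apply/ler_addgt0Pl => e e0.
have [Q Q0 cQ] := folner_interior K hF e0.
have c0 : 0 < #|` Q|%:R :> R by rewrite ltr0n cardfs_gt0.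
set Q' := [fset _ in _ | _] in cQ.
have mTD h : measurable (T h @^-1` D)%classic.
  by rewrite -[X in measurable X]setTI; exact: mT.
have : #|` Q'|%:R * p <= kap * #|` Q|%:R.
  rewrite -lee_fin EFinM fineK //.
  have -> : (#|` Q'|%:R%:E * mu D = \sum_(h <- Q') mu (T h @^-1` D))%E.
    under eq_bigr do rewrite muT //.
    rewrite -(fineK fD) sumEFin -EFinM; congr _%:E.
    by rewrite card_fset_sum1 natr_sum mulr_suml; apply: eq_bigr => h _; rewrite mul1r.
  under eq_bigr do rewrite -[X in mu X]setIT -integral_indic //.
  rewrite -ge0_integral_sum //; last first.
    by move=> h; apply/measurable_EFinP; exact: measurable_indic.
  apply: (@le_trans _ _ (\int[mu]_x (kap * #|` Q|%:R)%:E)%E); last first.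
    rewrite integral_cst // [X in (_ * X)%E](_ : _ = 1%E) ?mule1 //.
    exact: probability_setT.
  apply: ge0_le_integral => //.
  - by move=> x _; apply: sume_ge0 => h _; rewrite lee_fin.
  - apply: emeasurable_sum => h.
    by apply/measurable_EFinP; exact: measurable_indic.
  move=> x _; rewrite sumEFin lee_fin; apply: le_trans (hD Q x).
  rewrite [leRHS](_ : _ = #|` [fset h in Q' | `[< D (T h x) >]]|%:R); last first.
    by congr (#|` _|%:R); apply/fsetP => h; rewrite !inE /= andbA.
  rewrite [X in _ <= X%:R]card_fset_sum1 natr_sum [leRHS]big_fset [leRHS]big_mkcond /=.
  apply: ler_sum => h _; rewrite indicE.
  by case: asboolP => Dx; [case: (_ \in _) | rewrite memNset].
have := ler_wpM2r p0 cQ => h1 h2.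
rewrite -(ler_pM2r c0); have h3 : e * p * #|` Q|%:R <= e * #|` Q|%:R.
  by rewrite ler_pM2r // ler_piMr // ltW.
lra.
Qed.

End Transference.

Lemma fluctuates_before_exists (R : realType) (alpha beta : R) N (a : nat -> R) :
  fluctuates alpha beta N a <-> exists L, fluctuates_before alpha beta N L a.
Proof.
split=> [[t [tlt ta]]|[L [t [tlt ta]]]].
  exists (t (2 * N)%N).+1, (fun i => t i.+1); split=> [i j /andP[ij jN]|i iN].
    exact: tlt.
  split; last by have := ta i.+1 iN; rewrite /=; case: (odd i).
  move: iN; rewrite leq_eqVlt => /orP[/eqP->//|iN].
  by rewrite ltnS ltnW // tlt.
exists (fun i => t i.-1); split=> [[//|i] [//|j] _ ij jN|[//|i] /= iN].
  by apply: tlt; rewrite -ltnS ij.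
by have [_] := ta i iN; case: (odd i).
Qed.

Lemma fluctuates_beforeS (R : realType) (alpha beta : R) N L L' (a : nat -> R) :
  (L <= L')%N -> fluctuates_before alpha beta N L a -> fluctuates_before alpha beta N L' a.
Proof.
move=> LL [t [tlt ta]]; exists t; split=> // i iN.
by have [tL ?] := ta i iN; split=> //; apply: leq_trans LL.
Qed.

(** Only finitely many values of [t] matter, so [t] may range over the countably many lists, read
    through [nth]; this gives a countable union. *)
Lemma measurable_fluctuates_before (R : realType) (d : measure_display)
    (X : measurableType d) (alpha beta : R) N L (a : nat -> X -> R) :
  (forall n, measurable_fun setT (a n)) ->
  measurable [set x | fluctuates_before alpha beta N L (a^~ x)].
Proof.
move=> ma.
pose B (s : seq nat) (i : nat) : set X := [set x | (i < 2 * N)%N ->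
  [/\ forall j, (j < i)%N -> (nth 0 s j < nth 0 s i)%N, (nth 0 s i < L)%N &
   if odd i then beta <= a (nth 0 s i) x else a (nth 0 s i) x <= alpha]].
rewrite (_ : [set x | _] = \bigcup_s \bigcap_i B s i); last first.
  apply/seteqP; split=> x.
    move=> [t [tlt ta]]; exists (mkseq t (2 * N)) => // i _ iN.
    rewrite nth_mkseq //; have [? ?] := ta i iN; split=> // j ji.
    by rewrite nth_mkseq ?tlt ?ji // (ltn_trans ji).
  move=> [s _ Bs]; exists (nth 0 s); split=> [i j /andP[ij jN]|i iN].
    by have [+ _ _] := Bs j I jN; exact.
  by have [] := Bs i I iN.
apply: countable_bigcupT_measurable => // s; apply: bigcapT_measurable => i.
have mC : measurable [set x | if odd i then beta <= a (nth 0 s i) x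
    else a (nth 0 s i) x <= alpha].
  case: (odd i); rewrite -[X in measurable X]setTI;
    exact: measurable_fun_le.
rewrite /B; case: (boolP (i < 2 * N)%N) => iN; last first.
  by rewrite (_ : [set x | _] = setT) // -subTset => x _.
have [P|nP] := pselect ((forall j, (j < i)%N -> (nth 0 s j < nth 0 s i)%N)
  /\ (nth 0 s i < L)%N).
  rewrite (_ : [set x | _] = [set x | if odd i then beta <= a (nth 0 s i) x
    else a (nth 0 s i) x <= alpha]) //.
  by case: P => P1 P2; apply/seteqP; split=> x /= => [/(_ isT)[]|].
rewrite (_ : [set x | _] = set0) // -subset0 => x /(_ isT)[? ? _].
exact: nP.
Qed.

(** * Functions bounded everywhere *)

Section BoundedFunctions.
Variables (R : realType) (G : groupType) (F : nat -> {fset G}).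
Variables (alpha beta S : R) (N L k J : nat).
(** With [b = S + |alpha| + |beta|], a bound for [psi], this makes [2 b eps] the distance
    [(beta - alpha) / 2] from the midpoint to either end of the gap. *)
Let eps := (beta - alpha) / (4 * (S + `|alpha| + `|beta|)).
Hypothesis gap : alpha < beta.
Hypothesis S_gt0 : 0 < S.
Hypothesis hF : folner R F.
Hypothesis tF : bi_tempered (1 + eps / 64) F.
Hypothesis k_ge : 32 <= eps ^+ 2 * k%:R.
Hypothesis kJN : (k * J < N)%N.
Variables (d : measure_display) (X : measurableType d) (mu : probability X R).
Variables (T : G -> X -> X) (f : X -> R).
Hypothesis hT : mp_action mu T.
Hypothesis mf : measurable_fun setT f.
Hypothesis fS : forall x, `|f x| <= S.

Lemma measurable_ergodic_average n : measurable_fun setT (ergodic_average T F f n).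
Proof.
apply: measurable_funM => //; apply: measurable_sum => g.
exact: measurableT_comp mf (mp_action_measurable hT g).
Qed.

(** As [T (g * h) x = T g (T h x)], fluctuations at [T h x] become statements about sums over the
    tiles [F_n h]. *)
Lemma sum_rtile_orbit n h x (c : R) (m : nat) :
  \sum_(y <- rtile (F n) h) (-1) ^+ m * (f (T y x) - c) =
  (-1) ^+ m * (ergodic_average T F f n (T h x) - c) * #|` F n|%:R.
Proof.
have F0 : #|` F n|%:R != 0 :> R by rewrite pnatr_eq0 cardfs_eq0 (hF.1 n).
rewrite -mulr_sumr -mulrA; congr (_ * _).
rewrite sum_rtile big_split /= mulrBl /ergodic_average mulfVK //.
congr (_ + _); first by apply: eq_bigr => g _; rewrite (mp_actionM hT).
by rewrite card_fset_sum1 natr_sum -mulNr mulr_sumr; apply: eq_bigr => *; rewrite mulr1.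
Qed.

Lemma measure_fluctuates_before :
  (mu [set x | fluctuates_before alpha beta N L
     (fun n => ergodic_average T F f n x)] <= (4 / (1 + eps / 2) ^+ J)%:E)%E.
Proof.
pose b := S + `|alpha| + `|beta|.
have b0 : 0 < b by rewrite /b -addrA ltr_wpDr // addr_ge0.
have S0 := S_gt0; have gap0 := gap.
have ab : beta - alpha <= b.
  have := ler_norm beta; have := ler_norm (- alpha); rewrite normrN /b; lra.
have epsb : 2 * b * eps = (beta - alpha) / 2.
  rewrite /eps -/b; field; exact: lt0r_neq0.
have e0 : 0 < eps by rewrite divr_gt0 ?subr_gt0 // mulr_gt0.
have e2 : eps <= 2^-1.
  rewrite /eps -/b ler_pdivrMr ?mulr_gt0 //; lra.
have pJ : 0 < (1 + eps / 2) ^+ J by rewrite exprn_gt0 // addr_gt0 // divr_gt0.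
(* A translate of this union lying inside [Q] contains every tile that a fluctuation before [L] can
   use. *)
apply: (@transference R G F d X mu T _ (\bigcup_(n <- iota 0 L) F n)%fset) => //.
  exact: measurable_fluctuates_before measurable_ergodic_average.
move=> Q x; rewrite mulrAC ler_pdivlMr // mulrC.
set E := [fset _ in _ | _]%fset.
have EP h : exists t : nat -> nat, h \in E ->
    [/\ (rtile (\bigcup_(n <- iota 0 L) F n) h `<=` Q)%fset,
     (forall i j, (i < j < 2 * N)%N -> (t i < t j)%N) &
     forall i, (i < 2 * N)%N -> (t i < L)%N /\
       if odd i then beta <= ergodic_average T F f (t i) (T h x)
       else ergodic_average T F f (t i) (T h x) <= alpha].
  have [|nE] := boolP (h \in E); last by exists id.
  by rewrite !inE /= => /and3P[_ KQ /asboolP[t [t1 t2]]]; exists t.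
have [t tP] := choice EP.
apply: (@card_fluctuation_bi_tempered R G F eps b
  (fun y => f (T y x) - (alpha + beta) / 2) E Q t N L k J) => //.
- move=> y; apply: le_trans (ler_normB _ _) _; rewrite /b -addrA lerD //.
  rewrite normrM normfV normr_nat.
  by have := ler_normD alpha beta; have := normr_ge0 alpha; have := normr_ge0 beta; lra.
- exact: hF.1.
- by move=> h i j /tP[_ + _]; apply.
- move=> h i /tP[KQ _ ti] iN; have [tL ai] := ti i iN; split=> //.
    apply: fsubset_trans KQ; apply: rtileS.
    by apply: bigfcup_sup; rewrite ?mem_iota.
  rewrite sum_rtile_orbit ler_wpM2r // epsb -signr_odd /=.
  by case: (odd i) ai => /= ai; rewrite ?expr0 ?expr1; lra.
- by apply: fsubset_leq_card; apply/fsubsetP => h; rewrite !inE => /andP[].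
Qed.

End BoundedFunctions.

(** * Essentially bounded functions *)

Section EssentiallyBounded.
Variables (R : realType) (d : measure_display) (X : measurableType d).
Variable mu : probability X R.

Lemma ae_le_Lnorm_pinfty (f : X -> R) (S : R) :
  (Lnorm mu +oo (EFin \o f) <= S%:E)%E -> \forall x \ae mu, `|f x| <= S.
Proof.
rewrite unlock /Lnorm (_ : (0 < mu setT)%E); last first.
  by rewrite [X in (_ < X)%E](_ : _ = 1%E) //; exact: probability_setT.
move=> /ess_sup_inf.ess_supP; apply: filterS => x /=.
by rewrite lee_fin.
Qed.

Lemma ae_mp_action (G : groupType) (T : G -> X -> X) (P : set X) (g : G) :
  mp_action mu T -> (\forall x \ae mu, P x) -> \forall x \ae mu, P (T g x).
Proof.
move=> [_ _ mT muT] [A [mA A0 PA]]; exists (T g @^-1` A); split.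
- by rewrite -[X in measurable X]setTI; exact: mT.
- by rewrite muT.
- by move=> x /= nP; apply: PA.
Qed.

Lemma le_measure_ae (A B : set X) : measurable A -> measurable B ->
  (\forall x \ae mu, A x -> B x) -> (mu A <= mu B)%E.
Proof.
move=> mA mB [Z [mZ Z0 ABZ]]; rewrite -[leRHS]adde0 -Z0.
apply: le_trans (measureU2 _ mB mZ); apply: le_measure.
- by rewrite inE.
- by rewrite inE; exact: measurableU.
move=> x Ax; have [Bx|nBx] := pselect (B x); [by left|right].
by apply: ABZ => /= /(_ Ax).
Qed.

End EssentiallyBounded.

Lemma measurable_fluctuation_set (R : realType) (G : groupType) (d : measure_display)
    (X : measurableType d) (mu : probability X R) (T : G -> X -> X)
    (F : nat -> {fset G}) (alpha beta : R) (N : nat) (f : X -> R) :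
  mp_action mu T -> measurable_fun setT f ->
  measurable (fluctuation_set T F f alpha beta N).
Proof.
move=> hT mf; rewrite (_ : fluctuation_set _ _ _ _ _ _ = \bigcup_L
    [set x | fluctuates_before alpha beta N L (fun n => ergodic_average T F f n x)]).
  apply: bigcupT_measurable => L; apply: measurable_fluctuates_before => n.
  exact: measurable_ergodic_average hT mf n.
apply/seteqP; split=> x.
  by move=> /fluctuates_before_exists[L ?]; exists L.
by move=> [L _ ?]; apply/fluctuates_before_exists; exists L.
Qed.

Lemma measure_fluctuation_set (R : realType) (G : groupType) (F : nat -> {fset G})
    (alpha beta S : R) (N k J : nat)
    (eps := (beta - alpha) / (4 * (S + `|alpha| + `|beta|)))
    (d : measure_display) (X : measurableType d) (mu : probability X R)
    (T : G -> X -> X) (f : X -> R) :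
  alpha < beta -> 0 < S -> folner R F -> bi_tempered (1 + eps / 64) F ->
  32 <= eps ^+ 2 * k%:R -> (k * J < N)%N -> mp_action mu T ->
  f \in Lfun mu +oo%E -> (Lnorm mu +oo (EFin \o f) <= S%:E)%E ->
  (mu (fluctuation_set T F f alpha beta N) <= (4 / (1 + eps / 2) ^+ J)%:E)%E.
Proof.
move=> gap S0 hF tF k32 kJN hT /sub_Lfun_mfun; rewrite inE /= => mf /ae_le_Lnorm_pinfty fS.
(* Truncation makes the bound [S] hold everywhere. *)
pose f' x := if `|f x| <= S then f x else 0.
have mf' : measurable_fun setT f'.
  apply: measurable_fun_ifT => //; apply: measurable_fun_ler => //.
  exact: measurableT_comp.
have f'S x : `|f' x| <= S.
  by rewrite /f'; case: ifP => // _; rewrite normr0 ltW.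
apply: (@le_trans _ _ (mu (fluctuation_set T F f' alpha beta N))).
  have mfl g := @measurable_fluctuation_set _ _ _ _ _ _ F alpha beta N g hT.
  apply: le_measure_ae; [exact: mfl..|].
  (* The averages involve countably many translates of [f], so outside one null set truncation
     changes none of them. *)
  have : \forall x \ae mu, forall n, forall g, g \in F n -> `|f (T g x)| <= S.
    apply/ae_foralln => n.
    have : \forall x \ae mu, forall g, g \in enum_fset (F n) -> `|f (T g x)| <= S.
      elim: (enum_fset (F n)) => [|g s IH]; first by apply: nearW => x g.
      have gS := ae_mp_action g hT fS.
      near=> x => h; rewrite inE => /orP[/eqP->|].
        by near: x.
      by move: h; near: x.
    by [].
  apply: filterS => x xS; rewrite /fluctuation_set /=.
  rewrite (_ : (fun n => _) = (fun n => ergodic_average T F f' n x)) //.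
  apply/funext => n; congr (_ / _); apply: eq_big_seq => g gF.
  by rewrite /f' (xS n).
pose D L := [set x | fluctuates_before alpha beta N L
  (fun n => ergodic_average T F f' n x)].
have -> : fluctuation_set T F f' alpha beta N = \bigcup_L D L.
  apply/seteqP; split=> x.
    by move=> /fluctuates_before_exists[L ?]; exists L.
  by move=> [L _ ?]; apply/fluctuates_before_exists; exists L.
have mD L : measurable (D L).
  apply: measurable_fluctuates_before => n.
  exact: measurable_ergodic_average hT mf' n.
(* The bound is uniform in [L], so continuity from below removes the restriction on the indices. *)
have Dcvg : mu (D L) @[L --> \oo] --> mu (\bigcup_L D L).
  apply: nondecreasing_cvg_mu => //; first exact: bigcupT_measurable.
  by move=> L L' LL; apply/subsetPset => x; exact: fluctuates_beforeS.
rewrite -(cvg_lim _ Dcvg) //; apply: lime_le.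
  by apply/cvg_ex; exists (mu (\bigcup_L D L)).
by apply: nearW => L; apply: (@measure_fluctuates_before _ _ _ _ _ S _ _ k).
Unshelve. all: by end_near. Qed.

(** * The exponential rate *)

Lemma bernoulli_le (R : realDomainType) (x : R) n : 0 <= x <= 1 ->
  1 - n%:R * x <= (1 - x) ^+ n.
Proof.
move=> /andP[x0 x1]; elim: n => [|n IH]; first by rewrite mul0r subr0 expr0.
rewrite exprS; apply: le_trans (ler_wpM2l _ IH); last by rewrite subr_ge0.
have : 0 <= n%:R * x * x by rewrite !mulr_ge0.
by rewrite -natr1; lra.
Qed.

Theorem theorem1p2 (R : realType) (G : groupType)
    (hcount : countable [set: G]) (hamen : amenable R G)
    (alpha beta S : R) (hgap : alpha < beta) (hS : 0 < S) :
  exists lambda c0 : R, 0 < lambda /\ 0 < c0 < 1 /\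
    forall F : nat -> {fset G}, folner R F -> bi_tempered (1 + lambda) F ->
    exists c1 : R, 0 < c1 /\
      forall (d : measure_display) (X : measurableType d)
        (mu : probability X R) (T : G -> X -> X), mp_action mu T ->
      forall f : X -> R, f \in Lfun mu +oo%E ->
        (Lnorm mu +oo (EFin \o f) <= S%:E)%E ->
      forall N : nat,
        (mu (fluctuation_set T F f alpha beta N) <= (c1 * c0 ^+ N)%:E)%E.
Proof.
pose eps := (beta - alpha) / (4 * (S + `|alpha| + `|beta|)).
have e0 : 0 < eps.
  by rewrite divr_gt0 ?subr_gt0 // mulr_gt0 // -addrA ltr_wpDr // addr_ge0.
have [k k1 k32] : exists2 k : nat, (0 < k)%N & 32 <= eps ^+ 2 * k%:R.
  have q0 : 0 <= 32 / eps ^+ 2 by rewrite divr_ge0 // exprn_ge0 // ltW.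
  have := archi_boundP q0; move: (Num.bound _) => n nP.
  exists n.+1 => //; rewrite mulrC -ler_pdivrMr ?exprn_gt0 //.
  by apply: le_trans (ltW nP) _; rewrite ler_nat.
have k0 : 0 < k%:R :> R by rewrite ltr0n.
pose r := 1 + eps / 2; have r1 : 1 < r by rewrite /r; lra.
have r0 : 0 < r by lra.
(* Chosen so that [c0 ^+ k >= r^-1] by Bernoulli's inequality. *)
pose x := (1 - r^-1) / k%:R; pose c0 := 1 - x.
have ri : 0 < r^-1 < 1 by rewrite invr_gt0 r0 invf_lt1.
have x0 : 0 < x by rewrite divr_gt0 //; lra.
have x1 : x < 1.
  rewrite ltr_pdivrMr // mul1r; apply: (@lt_le_trans _ _ 1); first by lra.
  by rewrite ler1n.
have c00 : 0 < c0 by rewrite /c0; lra.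
have c01 : c0 < 1 by rewrite /c0; lra.
have c0k : r^-1 <= c0 ^+ k.
  apply: le_trans (@bernoulli_le R x k _); last by rewrite !ltW.
  by rewrite /x mulrCA divff ?gt_eqF //; lra.
exists (eps / 64), c0; split; first by rewrite divr_gt0.
split; first by rewrite c00.
(* The factor [c0 ^- k] pays for replacing [N] by [k * J], the largest multiple of [k] below it. *)
move=> F hF tF; exists (4 / c0 ^+ k); split; first by rewrite divr_gt0 // exprn_gt0.
move=> d X mu T hT f fL fS N.
have ck0 : 0 < c0 ^+ k by rewrite exprn_gt0.
(* For [N = 0] no [J] satisfies [k * J < N]; there [c1 >= 1] suffices. *)
have [->|N0] := posnP N.
  apply: (@le_trans _ _ 1%E).
    apply/probability_le1/measurable_fluctuation_set; first exact: hT.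
    by move: fL => /sub_Lfun_mfun; rewrite inE.
  rewrite lee_fin mulr1 ler_pdivlMr // mul1r.
  by apply: le_trans (exprn_ile1 _ (ltW c00) (ltW c01)) _; rewrite ler1n.
pose J := (N.-1 %/ k)%N.
have kJN : (k * J < N)%N by rewrite mulnC -(prednK N0) ltnS leq_trunc_div.
apply: le_trans (measure_fluctuation_set hgap hS hF tF k32 kJN hT fL fS) _.
rewrite -/eps -/r lee_fin -mulrA ler_pM2l // -exprVn.
apply: (@le_trans _ _ (c0 ^+ (k * J))).
  by rewrite exprM lerXn2r // nnegrE ltW //; case/andP: ri.
rewrite mulrC ler_pdivlMr // -exprD ler_wiXn2l ?(ltW c00) ?(ltW c01) //.
by rewrite -mulnSr mulnC -[leqLHS](prednK N0) ltn_ceil.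
Qed.
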